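(* Let $0<\varepsilon<1$ and let $n(m):=n_\varepsilon(m)$ for $m\ge 0$. Then, for every $m\geq 1$, the total cost $C_m$ after $m$ steps of the sequential sampling algorithm (described in the context, run with these sample sizes) satisfies $$ n(m)+\tfrac12\, n(m-1)-2c\;\leq\; \mathbb{E}(C_m)\;\leq\; n(m)+n(m-1)+1 .$$
   Context: Constants and sample sizes. $c:=\frac{2}{1-\ln 2}$. For $0<\varepsilon<1$ and $m\ge1$, $n_\varepsilon(m):=\lceil c\,m\,(\ln(2m)-\ln\varepsilon)\rceil$, and $n_\varepsilon(0):=0$. Spaces and measures. $D\subseteq\mathbb{R}^d$ is a domain, $\rho$ a probability measure on $D$, and $\varphi_1,\varphi_2,\dots$ is a given sequence of functions in $L^2(D,\rho)$ such that for each $m\geq1$, $\{\varphi_1,\dots,\varphi_m\}$ is an $L^2(D,\rho)$-orthonormal basis of a space $V_m$ (so $V_1\subset V_2\subset\cdots$). Put $d\sigma_j:=|\varphi_j|^2\,d\rho$ and $d\mu_m:=\frac1m\sum_{j=1}^m|\varphi_j|^2\,d\rho$, which are probability measures. Sequential sampling algorithm (Algorithm 1). Let $(n(m))_{m\ge1}$ be the increasing sequence of prescribed sample sizes. Start with $S_1=\{x_1^1,\dots,x_1^{n(1)}\}$ consisting of $n(1)$ i.i.d. draws from $\mu_1$. Given $S_m=\{x_m^1,\dots,x_m^{n(m)}\}$, produce $S_{m+1}=\{x_{m+1}^1,\dots,x_{m+1}^{n(m+1)}\}$ as follows, all new random draws being independent of each other and of everything drawn before. For $i=1,\dots,n(m)$: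 draw $a_i$ uniformly in $\{1,\dots,m+1\}$; if $a_i=m+1$, draw $x_{m+1}^i$ from $\sigma_{m+1}$; otherwise set $x_{m+1}^i:=x_m^i$. For $i=n(m)+1,\dots,n(m+1)$: draw $x_{m+1}^i$ from $\mu_{m+1}$ (by drawing $j$ uniformly in $\{1,\dots,m+1\}$ and then drawing from $\sigma_j$). Total cost. $C_m$ is the total number of sample points drawn (from $D$) in order to generate $S_1,\dots,S_m$. Explicitly, $C_m=n(m)+s(m)$ with $s(m)=\sum_{k=1}^{m-1}\sum_{i=1}^{n(k)}b^i_{k+1}$, where $b^i_{k+1}$ is the indicator of the event that $a_i=k+1$ in the step from $S_k$ to $S_{k+1}$; the $b^i_{k+1}$ are independent Bernoulli random variables with $\Pr(b^i_{k+1}=1)=\frac1{k+1}$. *)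

(* Defs.v *)
From mathcomp Require Import all_boot all_order all_algebra.
From mathcomp Require Import all_classical all_reals all_analysis.

Set Implicit Arguments.
Unset Strict Implicit.
Unset Printing Implicit Defensive.

Import Order.TTheory GRing.Theory Num.Theory.
Import numFieldNormedType.Exports.

Local Open Scope classical_set_scope.
Local Open Scope ring_scope.

Notation borel_rV R d := (g_sigma_algebraType (@open 'rV[R]_d)).

Definition domain (R : realType) (d : nat) (D : set 'rV[R]_d) : Prop :=
  [/\ D !=set0, open D & connected D].

Section SampleSizes.
Context {R : realType}.

Definition cst_c : R := 2 / (1 - ln 2).

(* For 0 < eps < 1 and m >= 1 the ceiling is a nonnegative integer, so that
   the absolute value merely casts it from int to nat. *)
Definition n_eps (eps : R) (m : nat) : nat :=
  if m is 0%N then 0%N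
  else `|Num.ceil (cst_c * m%:R * (ln (2 * m%:R) - ln eps))|%N.

End SampleSizes.

(* The space L^2(D, rho) is rendered by a Borel probability rho on R^d with
   rho D = 1 and by functions whose extension by 0 outside D is in L^2(rho).
   The sequence phi is indexed from 1: phi 0 is never used. *)
Section BasisAndMeasures.
Context {R : realType} {d : nat}.
Variables (D : set (borel_rV R d)) (rho : probability (borel_rV R d) R).
Variable phi : nat -> borel_rV R d -> R.

(* Orthonormality is all there is to being an orthonormal basis of V_m, as
   V_m is then the linear span of phi 1, ..., phi m. *)
Definition orthonormal_L2 : Prop :=
  (forall j, (0 < j)%N -> phi j \_ D \in Lfun rho 2%:E) /\
  (forall i j, (0 < i)%N -> (0 < j)%N ->
    (\int[rho]_(x in D) (phi i x * phi j x)%:E = ((i == j)%:R : R)%:E)%E).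

Definition sigma_ (j : nat) (A : set (borel_rV R d)) : \bar R :=
  (\int[rho]_(x in A `&` D) (`|phi j x| ^+ 2)%:E)%E.

Definition mu_ (m : nat) (A : set (borel_rV R d)) : \bar R :=
  ((m%:R^-1 : R)%:E * \sum_(1 <= j < m.+1) sigma_ j A)%E.

End BasisAndMeasures.

Section Independence.
Context {R : realType} {dO : measure_display} {Omega : measurableType dO}.
Variable P : probability Omega R.

Definition sigma_RV d' (T : measurableType d') (X : Omega -> T) :
    set (set Omega) :=
  preimage_set_system setT X measurable.

(* Mutual independence of the set systems F i for i in U; the finite subfamilies
   are enumerated without repetition by injections from 'I_n. *)
Definition mutually_independent (I : Type) (U : set I)
    (F : I -> set (set Omega)) : Prop :=
  forall (n : nat) (idx : 'I_n -> I) (A : 'I_n -> set Omega),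
    injective idx -> (forall l, U (idx l)) -> (forall l, F (idx l) (A l)) ->
    P (\bigcap_(l in [set: 'I_n]) A l) = (\prod_(l < n) fine (P (A l)))%:E.

Definition has_law d' (T : measurableType d') (X : {RV P >-> T})
    (nu : set T -> \bar R) : Prop :=
  forall A : set T, measurable A -> distribution P X A = nu A.

Definition uniform_upto (k : nat) (X : {RV P >-> nat}) : Prop :=
  forall j, (1 <= j <= k)%N -> P (X @^-1` [set j]) = (k%:R^-1 : R)%:E.

End Independence.

(* The random inputs of the algorithm. The first index k is the step that
   produces S_k and the second one is the position i in S_k:
   - coin k i   : the number a_i drawn in the step from S_(k-1) to S_k;
   - redraw k i : the draw from sigma_k, looked at only if coin k i = k;
   - new k i    : the draw from mu_k at a position i > n(k-1). *)
Record inputs (R : realType) (dO : measure_display) (Omega : measurableType dO)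
    (P : probability Omega R) (dT : measure_display) (T : measurableType dT) :=
  Inputs {
    coin : nat -> nat -> {RV P >-> nat};
    redraw : nat -> nat -> {RV P >-> T};
    new : nat -> nat -> {RV P >-> T}
  }.

Inductive input_index : Type :=
  | Coin of nat & nat
  | Redraw of nat & nat
  | New of nat & nat.

Section SequentialSampling.
Context {R : realType} {dO : measure_display} {Omega : measurableType dO}.
Context {P : probability Omega R} {dT : measure_display} {T : measurableType dT}.
Variables (n : nat -> nat) (X : inputs P T).

Definition used : set input_index := fun u =>
  match u with
  | Coin k i | Redraw k i => (1 < k)%N && (1 <= i <= n k.-1)%N
  | New 1 i => (1 <= i <= n 1)%N
  | New k i => (1 < k)%N && (n k.-1 < i <= n k)%N
  end.

Definition input_sigma (u : input_index) : set (set Omega) :=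
  match u with
  | Coin k i => sigma_RV (coin X k i)
  | Redraw k i => sigma_RV (redraw X k i)
  | New k i => sigma_RV (new X k i)
  end.

Definition valid_inputs (sigma mu : nat -> set T -> \bar R) : Prop :=
  [/\ forall k i, used (Coin k i) -> uniform_upto k (coin X k i),
      forall k i, used (Redraw k i) -> has_law (redraw X k i) (sigma k),
      forall k i, used (New k i) -> has_law (new X k i) (mu k)
    & mutually_independent P used input_sigma].

(* One step of the algorithm, from S = S_(k-1) to S_k: the point at position i,
   together with whether it has been drawn in this very step. *)
Definition step (k : nat) (S : nat -> T) (w : Omega) (i : nat) : T * bool :=
  if (i <= n k.-1)%N then
    if coin X k i w == k then (redraw X k i w, true) else (S i, false)
  else (new X k i w, true).

(* Only the positions 1 <= i <= n m are meaningful, and only for m >= 1. *)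
Fixpoint sample (m : nat) (w : Omega) : nat -> T * bool :=
  match m with
  | 0 | 1 => fun i => (new X m i w, true)
  | k.+1 => step k.+1 (fun i => (sample k w i).1) w
  end.

Definition total_cost (m : nat) (w : Omega) : nat :=
  (\sum_(1 <= k < m.+1) \sum_(1 <= i < (n k).+1) (sample k w i).2)%N.

End SequentialSampling.

(* Main.v *)
(** The cost is C_m = n(m) + sum_(k < m) sum_(i <= n(k)) 1[a_i = k+1], hence
    E(C_m) = n(m) + sum_(k < m) n(k) / (k+1). Put L_k = ln (2k) - ln eps.
    Since 1 <= c L_k, each n(k) / (k+1) is at most c L_k <= c L_(m-1), which
    gives the upper bound. For the lower bound, n(k) / (k+1) is at least
    c L_k k / (k+1), and k (L_(k+1) - L_k) <= 1 makes
    sum_(k <= M) L_k k / (k+1) grow at least as fast as M L_M / 2 from M = 4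
    on, while each of the three steps before loses at most 1/2. *)
Require Import Defs.
From mathcomp Require Import all_boot all_order all_algebra.
From mathcomp Require Import all_classical all_reals all_analysis.
From mathcomp Require Import measurable_realfun zify lra.

Import Order.TTheory GRing.Theory Num.Theory.
Import numFieldNormedType.Exports.

Local Open Scope classical_set_scope.
Local Open Scope ring_scope.

(** * The cost as a sum of indicators, and its expectation *)

Section Cost.
Context {R : realType} {dO : measure_display} {Omega : measurableType dO}.
Context {P : probability Omega R} {dT : measure_display} {T : measurableType dT}.
Variables (n : nat -> nat) (X : inputs P T).

(** In step [k.+1] a position up to [n k] costs a draw exactly when its coin shows [k.+1], and each
    later position always costs one; by monotonicity of [n] the latter draws telescope to [n m]. *)
Lemma total_costE m w :
  (forall k, (0 < k)%N -> (n k <= n k.+1)%N) -> (0 < m)%N ->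
  total_cost n X m w =
  (n m + \sum_(1 <= k < m) \sum_(1 <= i < (n k).+1) (coin X k.+1 i w == k.+1))%N.
Proof.
move=> n_mono; elim: m => // -[_ _|m IHm _].
  rewrite /total_cost big_nat1 [X in (_ + X)%N]big_geq // addn0.
  by rewrite sum_nat_const_nat subn1 muln1.
rewrite /total_cost big_nat_recr //= -/(total_cost n X m.+1 w) IHm //.
rewrite [in RHS]big_nat_recr //= [RHS]addnC -[LHS]addnA [LHS]addnC -addnA.
rewrite -[RHS]addnA; congr addn.
rewrite (big_cat_nat (n := (n m.+1).+1)) //=; last by rewrite ltnS n_mono.
rewrite -[LHS]addnA; congr addn.
  by apply: eq_big_nat => i /andP[_]; rewrite ltnS /step /= => ->; case: ifP.
rewrite (eq_big_nat _ _ (F2 := fun=> 1%N)); last first.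
  by move=> i /andP[i_gt _]; rewrite /step /= leqNgt i_gt.
by rewrite sum_nat_const_nat muln1 subSS subnK // n_mono.
Qed.

(** Linearity of expectation: each indicator [hit k i] has mean [1 / (k + 1)] by uniformity of the
    coin. *)
Lemma expectation_total_cost m :
  (forall k, (0 < k)%N -> (n k <= n k.+1)%N) ->
  (forall k i, used n (Coin k i) -> uniform_upto k (coin X k i)) -> (0 < m)%N ->
  ('E_P[fun w => (total_cost n X m w)%:R] =
   ((n m)%:R + \sum_(1 <= k < m) (n k)%:R / k.+1%:R)%:E)%E.
Proof.
move=> n_mono coin_unif m_gt0; rewrite unlock.
pose hit k i := coin X k.+1 i @^-1` [set k.+1].
have mhit k i : measurable (hit k i).
  by rewrite -[hit k i]setTI; exact: measurable_funP.
have mind k i : measurable_fun setT (fun w => (\1_(hit k i) w : R)%:E).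
  by apply/measurable_EFinP; exact: measurable_indic.
have hit0 k i w : (0 <= (\1_(hit k i) w : R)%:E)%E by rewrite lee_fin.
have costE w : ((total_cost n X m w)%:R)%:E =
    ((n m)%:R%:E + \sum_(1 <= k < m) \sum_(1 <= i < (n k).+1)
      (\1_(hit k i) w : R)%:E)%E.
  rewrite total_costE // natrD natr_sum EFinD; congr (_ + _)%E.
  rewrite -sumEFin; apply: eq_bigr => k _; rewrite natr_sum -sumEFin.
  apply: eq_bigr => i _; rewrite indicE; congr (_%:R%:E).
  by congr nat_of_bool; apply/eqP/idP; rewrite inE.
rewrite (eq_integral _ _ (fun w _ => costE w)) ge0_integralD //; first last.
- by apply: emeasurable_sum => k; exact: emeasurable_sum.
- by move=> w _; do 2!apply: sume_ge0 => ? _.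
rewrite EFinD; have := expectation_cst P (n m)%:R; rewrite unlock => ->; congr (_ + _)%E.
rewrite ge0_integral_sum //; first last.
- by move=> k w _; exact: sume_ge0.
- by move=> k; exact: emeasurable_sum.
rewrite -sumEFin; apply: eq_big_nat => k /andP[k_gt0 _].
rewrite ge0_integral_sum // (eq_big_nat _ _ (F2 := fun=> (k.+1%:R^-1)%:E)).
  by rewrite sumEFin big_const_nat subn1 /= iter_addr_0 mulr_natl.
move=> i i_le; rewrite integral_indic // setIT.
by apply: coin_unif; rewrite /= ?leqnn ?ltnS ?k_gt0.
Qed.

End Cost.

(** * A lower bound for weighted sums of a slowly growing sequence *)

Section WeightedSums.
Context {R : realType}.
Implicit Types L : nat -> R.

Lemma weighted_sum_ge L M :
  (forall k, (0 < k)%N -> 0 <= L k) ->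
  (forall k, k%:R * (L k.+1 - L k) <= 1) ->
  (forall k, (4 < k)%N -> 3 / 2 <= L k) ->
  M%:R * L M / 2 - 3 / 2 <= \sum_(1 <= k < M.+1) k%:R * L k / k.+1%:R.
Proof.
move=> L_ge0 L_incr L_ge.
(* Strengthened for the induction: [minn M.-1 3] counts the steps so far, among those from 1, 2 and
   3, that may lose 1/2. *)
suff: M%:R * L M / 2 - (minn M.-1 3)%:R / 2 <=
      \sum_(1 <= k < M.+1) k%:R * L k / k.+1%:R.
  have : (minn M.-1 3)%:R <= 3 :> R by rewrite ler_nat geq_minr.
  by lra.
elim: M => [|M IHM]; first by rewrite big_geq //= min0n !mul0r subrr.
rewrite big_nat_recr //=.
have L'_ge0 := L_ge0 M.+1 isT.
have wE : M.+1%:R * L M.+1 / M.+2%:R = L M.+1 * (M.+1%:R / M.+2%:R).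
  by rewrite mulrAC mulrC.
have := L_incr M; move: IHM; rewrite wE -(natr1 M) mulrDl mul1r mulrBr.
set t := (M%:R + 1) / _; set S := \sum_(_ <= _ < _) _.
have [M_ge4|M_lt4] := leqP 4 M.
  have -> : minn M.-1 3 = 3%N by lia.
  have -> : minn M 3 = 3%N by lia.
  (* The left side grows by at most [(L M.+1 + 1) / 2], the right side by [t * L M.+1]; with [t] at
     least 5/6, its value at [M = 4], [3 / 2 <= L M.+1] is just enough. *)
  have : 5 / 6 <= t.
    rewrite /t ler_pdivlMr // -(natr1 M.+1) -(natr1 M).
    have : 4 <= M%:R :> R by rewrite ler_nat.
    by lra.
  move=> /(ler_wpM2l L'_ge0); have := L_ge M.+1 M_ge4.
  by lra.
have -> : minn M 3 = M by lia.
have -> : minn M.-1 3 = M.-1 by lia.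
have : 1 / 2 <= t.
  rewrite /t ler_pdivlMr // -(natr1 M.+1) -(natr1 M).
  have : 0 <= M%:R :> R by [].
  by lra.
move=> /(ler_wpM2l L'_ge0).
(* From [M = 0] nothing is lost, since the increment of [L] has the factor 0. *)
clearbody t S; case: M {M_lt4 L'_ge0 wE} => [|M] /=; first by rewrite !mul0r; lra.
by rewrite -(natr1 M); lra.
Qed.

End WeightedSums.

(** * Logarithmic estimates and the sums of the sample sizes *)

Section SampleSizeBounds.
Context {R : realType}.

(** This is [ln (1 + x) <= x] at [x = - 1 / 2]. *)
Lemma ln2_ge_half : 1 / 2 <= ln 2 :> R.
Proof.
have /le_ln1Dx : -1 < - (1 / 2) :> R by lra.
have -> : 1 + - (1 / 2) = 2^-1 :> R by lra.
by rewrite lnV ?posrE //; lra.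
Qed.

Lemma ln2_lt1 : ln 2 < 1 :> R.
Proof.
by rewrite -[ltRHS]expRK ltr_ln ?posrE ?expR_gt0 //; exact: expR_gt1Dx.
Qed.

Lemma cst_c_ge2 : 2 <= cst_c :> R.
Proof.
have := ln2_ge_half; have := ln2_lt1 => ln2_lt ln2_ge.
by rewrite /cst_c ler_pdivlMr ?subr_gt0 //; lra.
Qed.

Variables (eps : R).
Hypothesis eps01 : 0 < eps < 1.

Let L (m : nat) : R := ln (2 * m%:R) - ln eps.

Let ln_eps_lt0 : ln eps < 0. Proof. exact: ln_lt0. Qed.

Lemma log_size_le j k : (0 < j <= k)%N -> L j <= L k.
Proof.
case/andP=> j_gt0 jk; rewrite lerB // ler_ln ?posrE ?mulr_gt0 ?ltr0n //.
  by rewrite ler_pM2l // ler_nat.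
exact: leq_trans jk.
Qed.

Lemma log_size_ge_half k : (0 < k)%N -> 1 / 2 <= L k.
Proof.
move=> k_gt0; apply: le_trans (log_size_le 1 k k_gt0).
by rewrite /L mulr1; have := ln2_ge_half; have := ln_eps_lt0; lra.
Qed.

Lemma log_size_ge k : (4 < k)%N -> 3 / 2 <= L k.
Proof.
move=> k_gt4; apply: le_trans (log_size_le 4 k (ltnW k_gt4)).
(* Thus [L 4] is [3 ln 2 - ln eps], where [ln 2] is at least 1/2. *)
have pow3 : 2 * 4 = 2 ^+ 3 :> R by rewrite -natrX -natrM.
by rewrite /L pow3 lnXn //; have := ln2_ge_half; have := ln_eps_lt0; lra.
Qed.

(** For positive [k] the increment is [ln (1 + 1 / k)], at most [1 / k]. *)
Lemma log_size_incr k : k%:R * (L k.+1 - L k) <= 1.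
Proof.
case: k => [|k]; first by rewrite mul0r.
have -> : L k.+2 - L k.+1 = ln (1 + k.+1%:R^-1).
  rewrite /L opprB addrA subrK -ln_div ?posrE ?mulr_gt0 //.
  by congr ln; rewrite -mulf_div divff // mul1r -natr1 mulrDl mul1r divff.
rewrite mulrC -ler_pdivlMr // mul1r le_ln1Dx //.
by apply: lt_le_trans (_ : 0 <= _); rewrite ?ltrN10 ?invr_ge0.
Qed.

Lemma n_eps_bounds k :
  cst_c * k%:R * L k <= (n_eps eps k)%:R <= cst_c * k%:R * L k + 1.
Proof.
case: k => [|k]; first by rewrite mulr0 mul0r add0r lexx ler01.
rewrite /n_eps -/(L _); set x := _ * L _.
have x_ge0 : 0 <= x.
  have L_ge0 : 0 <= L k.+1 by have := log_size_ge_half k.+1 isT; lra.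
  have c_ge0 : 0 <= cst_c :> R by have := cst_c_ge2; lra.
  by rewrite mulr_ge0 // mulr_ge0.
have -> : `|Num.ceil x|%N%:R = (Num.ceil x)%:~R :> R.
  by rewrite natr_absz ger0_norm // ceil_ge0 (lt_le_trans _ x_ge0) // ltrN10.
by rewrite ceil_ge /= -lerBlDr ltW // -[X in _ - X]/1%:~R -intrB gt_pred_ceil.
Qed.

Lemma n_eps_le k : (0 < k)%N -> (n_eps eps k <= n_eps eps k.+1)%N.
Proof.
case: k => // k _; rewrite /n_eps -!/(L _).
have c_ge0 : 0 <= cst_c :> R by have := cst_c_ge2; lra.
have L_ge0 : 0 <= L k.+1 by have := log_size_ge_half k.+1 isT; lra.
have LS := log_size_le k.+1 k.+2 (leqnSn _).
have le12 : cst_c * k.+1%:R * L k.+1 <= cst_c * k.+2%:R * L k.+2.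
  by apply: ler_pM => //; [exact: mulr_ge0 | rewrite ler_wpM2l ?ler_nat].
have ge0 : 0 <= Num.ceil (cst_c * k.+1%:R * L k.+1).
  by rewrite ceil_ge0 (@lt_le_trans _ _ 0) ?ltrN10 // mulr_ge0 // mulr_ge0.
rewrite -lez_nat !gez0_abs ?le_ceil //.
exact: le_trans ge0 (le_ceil le12).
Qed.

Lemma sum_n_eps_le m :
  \sum_(1 <= k < m.+1) (n_eps eps k)%:R / k.+1%:R <= (n_eps eps m)%:R :> R.
Proof.
have c_ge2 : 2 <= cst_c :> R := cst_c_ge2.
case/andP: (n_eps_bounds m) => + _; apply: le_trans.
rewrite mulrAC [leRHS]mulr_natr.
apply: (@le_trans _ _ (\sum_(1 <= k < m.+1) cst_c * L m)); last first.
  by rewrite sumr_const_nat subn1.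
apply: ler_sum_nat => k /andP[k_gt0 k_le].
have Lk := log_size_ge_half k k_gt0.
apply: (@le_trans _ _ (cst_c * L k)).
  rewrite ler_pdivrMr //; have /andP[_ /le_trans] := n_eps_bounds k; apply.
  (* The 1 lost to the ceiling is absorbed by [cst_c * L k], at least [2 * (1 / 2)]. *)
  by rewrite -natr1; nra.
rewrite ler_wpM2l ?log_size_le ?k_gt0 //; lra.
Qed.

Lemma sum_n_eps_ge m :
  2^-1 * (n_eps eps m)%:R - 2 * cst_c <=
  \sum_(1 <= k < m.+1) (n_eps eps k)%:R / k.+1%:R :> R.
Proof.
have c_ge2 : 2 <= cst_c :> R := cst_c_ge2.
apply: (@le_trans _ _
    (cst_c * \sum_(1 <= k < m.+1) k%:R * L k / k.+1%:R)); last first.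
  rewrite mulr_sumr; apply: ler_sum => k _.
  by rewrite mulrA ler_pM2r ?invr_gt0 // mulrA; case/andP: (n_eps_bounds k).
have L_ge0 k : (0 < k)%N -> 0 <= L k.
  by move=> /log_size_ge_half; lra.
have := weighted_sum_ge L m L_ge0 log_size_incr log_size_ge.
have /andP[_] := n_eps_bounds m.
(* Of the [2 * cst_c], the weighted sum takes [3 / 2 * cst_c]; the rest covers half of the ceiling's
   error 1. *)
by rewrite -mulrA; nra.
Qed.

End SampleSizeBounds.

Theorem theorem3p2 (R : realType) (d : nat) (D : set 'rV[R]_d)
    (rho : probability (borel_rV R d) R) (phi : nat -> borel_rV R d -> R)
    (dO : measure_display) (Omega : measurableType dO) (P : probability Omega R)
    (X : inputs P (borel_rV R d)) (eps : R) :
  domain D -> rho D = 1%E -> orthonormal_L2 D rho phi ->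
  0 < eps < 1 ->
  valid_inputs (n_eps eps) X (sigma_ D rho phi) (mu_ D rho phi) ->
  forall m : nat, (1 <= m)%N ->
    (((n_eps eps m)%:R + 2^-1 * (n_eps eps m.-1)%:R - 2 * cst_c)%:E
       <= 'E_P[fun w => (total_cost (n_eps eps) X m w)%:R]
       <= ((n_eps eps m)%:R + (n_eps eps m.-1)%:R + 1)%:E)%E.
Proof.
(* From here on [m] is the predecessor of the number of steps, possibly 0. *)
move=> _ _ _ eps01 [coin_unif _ _ _] [//|m] _.
rewrite expectation_total_cost //; last exact: n_eps_le.
rewrite !lee_fin -addrA lerD2l sum_n_eps_ge //= -addrA lerD2l.
by rewrite ler_wpDr // sum_n_eps_le.
Qed.
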